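(* The complete graph $K_N$ admits a swift phases configuration for every integer $N\ge 3$, and the complete bipartite graph $K_{N_1,N_2}$ admits a swift phases configuration for all integers $N_1,N_2\ge 2$.
   Context: Let $\mathcal{G}'$ be a finite simple undirected graph with $n$ vertices and adjacency matrix $\mathbf{A}$. A chiral adjacency matrix on $\mathcal{G}'$ is an $n\times n$ hermitian matrix $\tilde{\mathbf{A}}$ such that $\tilde{\mathbf{A}}_{jk}$ is a complex number of modulus $1$ whenever $\mathbf{A}_{jk}=1$, and $\tilde{\mathbf{A}}_{jk}=0$ whenever $\mathbf{A}_{jk}=0$ (in particular the diagonal is zero). $\mathcal{G}'$ admits a swift phases configuration if there exists a chiral adjacency matrix $\tilde{\mathbf{A}}$ on $\mathcal{G}'$ such that $\tilde{\mathbf{A}}\,\mathbf{1}_n=0$, where $\mathbf{1}_n$ is the all-ones vector, i.e. such that each row of $\tilde{\mathbf{A}}$ sums to zero. *)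

(* Defs.v *)
From HB Require Import structures.
From mathcomp Require Import all_boot all_order all_algebra.
From mathcomp Require Import sesquilinear reals.
From mathcomp Require Import complex.
Set Implicit Arguments.
Unset Strict Implicit.
Unset Printing Implicit Defensive.
Import Order.TTheory GRing.Theory Num.Theory.
Local Open Scope ring_scope.
Local Open Scope complex_scope.

Record sgraph (n : nat) := SGraph {
  edge :> rel 'I_n;
  edge_sym : symmetric edge;
  edge_irrefl : irreflexive edge }.

Definition adjmx n (G : sgraph n) : 'M[nat]_n := \matrix_(j, k) nat_of_bool (G j k).

(* The complex numbers are R[i], with R a model of the real numbers.  The
   zero-diagonal condition follows from the irreflexivity of the graph. *)
Definition chiral_adjmx (R : realType) n (G : sgraph n) (M : 'M[R[i]]_n) : Prop :=
  [/\ M \is hermsymmx,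
      forall j k, adjmx G j k = 1%N -> `|M j k| = 1
    & forall j k, adjmx G j k = 0%N -> M j k = 0].

Definition swift_phases (R : realType) n (G : sgraph n) : Prop :=
  exists M : 'M[R[i]]_n,
    chiral_adjmx G M /\ M *m (const_mx 1 : 'cV[R[i]]_n) = 0.

Definition complete_rel n : rel 'I_n := fun j k => j != k.

Lemma complete_rel_sym n : symmetric (@complete_rel n).
Proof. by move=> j k; rewrite /complete_rel eq_sym. Qed.

Lemma complete_rel_irrefl n : irreflexive (@complete_rel n).
Proof. by move=> j; rewrite /complete_rel eqxx. Qed.

Definition complete_graph n : sgraph n :=
  SGraph (@complete_rel_sym n) (@complete_rel_irrefl n).

(* The two parts are the vertices below n1 and the n2 remaining ones. *)
Definition complete_bipartite_rel n1 n2 : rel 'I_(n1 + n2) :=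
  fun j k => (j < n1)%N != (k < n1)%N.

Lemma complete_bipartite_rel_sym n1 n2 :
  symmetric (@complete_bipartite_rel n1 n2).
Proof. by move=> j k; rewrite /complete_bipartite_rel eq_sym. Qed.

Lemma complete_bipartite_rel_irrefl n1 n2 :
  irreflexive (@complete_bipartite_rel n1 n2).
Proof. by move=> j; rewrite /complete_bipartite_rel eqxx. Qed.

Definition complete_bipartite_graph n1 n2 : sgraph (n1 + n2) :=
  SGraph (@complete_bipartite_rel_sym n1 n2)
         (@complete_bipartite_rel_irrefl n1 n2).

(* Main.v *)
(* For K_N write M = A + iB with A real symmetric and B real antisymmetric.
   With sigma j k = (-1)^(j+k) for j < k and its opposite for j > k, each row
   of sigma sums to zero when N is odd, and M = i sigma works.  When N is even,
   row j of sigma sums to sigma j j', where j' is the vertex paired with j in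
   the perfect matching {2p, 2p+1}; so M is 1 on the matching and
   c + i sqrt(1 - c^2) sigma off it, with c = -1/(N-2).
   For K_{N1,N2} the off-diagonal block is x^j y^k, where x and y are roots of
   1 + X + ... + X^(N1-1) and 1 + X + ... + X^(N2-1). *)
Require Import Defs.
From mathcomp Require Import all_boot all_order all_algebra reals.
From mathcomp Require Import sesquilinear complex.
From mathcomp Require Import zify lra.
Set Implicit Arguments.
Unset Strict Implicit.
Unset Printing Implicit Defensive.
Import Order.TTheory GRing.Theory Num.Theory.
Local Open Scope ring_scope.
Local Open Scope complex_scope.

Lemma hermsymmxP (C : numClosedFieldType) n (M : 'M[C]_n) :
  (forall j k, M j k = (M k j)^*%R) -> M \is hermsymmx.
Proof.
move=> hM; apply/is_hermitianmxP; rewrite expr0 scale1r.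
by apply/matrixP => j k; rewrite !mxE hM.
Qed.

Lemma complex_split_sum (R : rcfType) n (a b : 'I_n -> R) :
  \sum_k (a k +i* b k) = (\sum_k a k) +i* (\sum_k b k).
Proof.
elim: n a b => [|n IHn] a b; first by rewrite !big_ord0.
by rewrite !big_ord_recl IHn.
Qed.

(** A matrix is hermitian exactly when its real part is symmetric and its imaginary part
    antisymmetric, so the question splits into real conditions on [a] and [b]. *)
Lemma swift_phases_complete (R : realType) n (a b : 'I_n -> 'I_n -> R) :
  (forall j k, a j k = a k j) -> (forall j k, b j k = - b k j) ->
  (forall j, a j j = 0) ->
  (forall j k, j != k -> a j k ^+ 2 + b j k ^+ 2 = 1) ->
  (forall j, \sum_k a j k = 0) -> (forall j, \sum_k b j k = 0) ->
  swift_phases R (complete_graph n).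
Proof.
move=> aC bC a0 ab1 sa sb; exists (\matrix_(j, k) (a j k +i* b j k)).
have b0 j : b j j = 0 by have := bC j j; lra.
split; first split.
- by apply: hermsymmxP => j k; rewrite !mxE aC bC.
- move=> j k; rewrite !mxE /= /complete_rel; case: eqP => //= /eqP jk _.
  by rewrite normc_def /= ab1 // sqrtr1.
- by move=> j k; rewrite !mxE /= /complete_rel; case: eqP => //= -> _; rewrite a0 b0.
- apply/colP => j; rewrite !mxE.
  under eq_bigr do rewrite !mxE mulr1.
  by rewrite complex_split_sum sa sb.
Qed.

(** The matrix sigma, indexed by [nat] so that row sums can be computed by induction on the number
    of columns. *)
Definition alt_sign (R : pzRingType) (j k : nat) : R :=
  if (j < k)%N then (-1) ^+ (j + k)
  else if (k < j)%N then - (-1) ^+ (j + k) else 0.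

Lemma alt_signC (R : pzRingType) j k : alt_sign R j k = - alt_sign R k j.
Proof. by rewrite /alt_sign addnC; case: ltngtP; rewrite ?opprK ?oppr0. Qed.

Lemma alt_sign_sqr (R : pzRingType) j k : j != k -> alt_sign R j k ^+ 2 = 1.
Proof.
by rewrite /alt_sign; case: ltngtP => // _ _; rewrite ?sqrrN sqrr_sign.
Qed.

(** Once the zero at [k = j] is skipped, row [j] alternates in sign across the diagonal, starting
    from [- (-1) ^+ j]. Its [n - 1] nonzero entries thus cancel in pairs, up to the first one when
    [n] is even. *)
Lemma sum_alt_sign (R : pzRingType) j n : (j < n)%N ->
  \sum_(k < n) alt_sign R j k = (if odd n then 0 else - (-1) ^+ j).
Proof.
(* Before the diagonal no entry has been skipped, so the two parities are exchanged. *)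
have below m : (m <= j)%N ->
    \sum_(k < m) alt_sign R j k = if odd m then - (-1) ^+ j else 0.
  elim: m => [|m IHm] lemj; first by rewrite big_ord0.
  rewrite big_ord_recr /= IHm ?(ltnW lemj) // /alt_sign ltnNge (ltnW lemj) lemj /=.
  rewrite exprD -[(-1) ^+ m]signr_odd.
  by case: odd; rewrite /= ?expr1 ?expr0 ?mulrN1 ?mulr1 ?opprK ?addNr ?add0r.
elim: n => // n IHn; rewrite ltnS leq_eqVlt => /predU1P[<-|jn].
  rewrite big_ord_recr /= below // /alt_sign ltnn addr0.
  by case: ifP.
rewrite big_ord_recr /= IHn // /alt_sign jn exprD -[(-1) ^+ n]signr_odd.
by case: odd; rewrite /= ?expr1 ?expr0 ?mulrN1 ?mulr1 ?add0r ?addNr.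
Qed.

Lemma swift_phases_complete_odd (R : realType) n :
  odd n -> swift_phases R (complete_graph n).
Proof.
move=> on; apply: (@swift_phases_complete _ _ (fun _ _ => 0)
  (fun j k => alt_sign R j k)) => //.
- by move=> j k; apply: alt_signC.
- by move=> j k jk; rewrite expr0n add0r alt_sign_sqr.
- by move=> j; rewrite big1.
- by move=> j; rewrite sum_alt_sign // on.
Qed.

Definition mate (j : nat) : nat := if odd j then j.-1 else j.+1.

Lemma mate_neq j : mate j != j.
Proof. by rewrite /mate; case: ifP; lia. Qed.

Lemma mate_sym j k : (k == mate j) = (j == mate k).
Proof. by rewrite /mate; do 2 case: ifP; lia. Qed.

Lemma mate_lt n j : ~~ odd n -> (j < n)%N -> (mate j < n)%N.
Proof. by rewrite /mate; case: ifP; lia. Qed.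

(** This is the row sum found in [sum_alt_sign] for even [n]: deleting the mate's entry leaves a row
    of sum zero. *)
Lemma alt_sign_mate (R : pzRingType) j : alt_sign R j (mate j) = - (-1) ^+ j.
Proof.
rewrite /alt_sign /mate -[in RHS]signr_odd.
case oj: (odd j); last by rewrite ltnSn -signr_odd oddD /= oj.
case: j oj => //= j oj; rewrite ltnNge leqnSn ltnSn /=.
by rewrite -signr_odd oddD /= oj; case: odd oj.
Qed.

Lemma swift_phases_complete_even (R : realType) n :
  ~~ odd n -> (3 <= n)%N -> swift_phases R (complete_graph n).
Proof.
(* [c] solves [1 + (n - 2) c = 0], the row sum of the real part; [n - 2 >= 1] gives [c ^+ 2 <= 1],
   so [s] below completes [c] to modulus 1. *)
move=> en n3; pose c : R := - (n - 2)%:R^-1.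
have n2 : (1 : R) <= (n - 2)%:R by rewrite (ler_nat _ 1); lia.
have c1 : c ^+ 2 <= 1.
  by rewrite sqrrN exprVn invf_le1 ?exprn_ege1 // exprn_gt0 //; lra.
pose s := Num.sqrt (1 - c ^+ 2).
have cs : c ^+ 2 + s ^+ 2 = 1 by rewrite sqr_sqrtr ?subr_ge0 // addrC subrK.
pose p (j : 'I_n) : 'I_n := Ordinal (mate_lt en (ltn_ord j)).
have pN j : p j != j by rewrite -val_eqE mate_neq.
have pS j k : (k == p j) = (j == p k) by rewrite -!val_eqE /= mate_sym.
apply: (@swift_phases_complete _ _
  (fun j k => if k == j then 0 else if k == p j then 1 else c)
  (fun j k => if k == p j then 0 else s * alt_sign R j k)).
- by move=> j k; rewrite [k == j]eq_sym pS.
- by move=> j k; rewrite pS alt_signC mulrN; case: ifP => // _; rewrite oppr0.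
- by move=> j; rewrite eqxx.
- move=> j k jk; rewrite eq_sym (negbTE jk); case: ifP => _.
    by rewrite expr1n expr0n addr0.
  by rewrite exprMn alt_sign_sqr // mulr1.
- move=> j; rewrite (bigD1 j) //= eqxx add0r (bigD1 (p j)) ?pN //=.
  rewrite (negbTE (pN j)) eqxx.
  rewrite (eq_bigr (fun=> c)); last first.
    by move=> k /andP[/negbTE-> /negbTE->].
  have -> : \sum_(k | (k != j) && (k != p j)) c = c *+ (n - 2).
    rewrite sumr_const; congr (_ *+ _).
    have := cardsC [set j; p j]; rewrite cards2 eq_sym pN card_ord => /(canRL (addKn _)) <-.
    by apply: eq_card => k; rewrite !inE negb_or.
  rewrite -mulr_natr mulNr mulVf ?subrr //; apply/eqP; lra.
- move=> j; rewrite (bigD1 (p j)) //= eqxx add0r.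
  rewrite (eq_bigr (fun k : 'I_n => s * alt_sign R j k)); last first.
    by move=> k /negbTE->.
  rewrite -mulr_sumr; have := sum_alt_sign R (ltn_ord j).
  rewrite (negbTE en) (bigD1 (p j)) //= alt_sign_mate => /(canRL (addKr _)) ->.
  by rewrite addNr mulr0.
Qed.

(** A root of [1 + X + ... + X^(n-1)] exists by algebraic closure, and it has modulus 1 because
    multiplying by [X - 1] gives [x ^+ n = 1]. *)
Lemma sum_expr_eq0_exists (C : numClosedFieldType) n : (2 <= n)%N ->
  exists2 x : C, `|x| = 1 & \sum_(k < n) x ^+ k = 0.
Proof.
case: n => // n n1.
(* Here [n] is already the predecessor, that is, the degree of the polynomial, and [n1] says that it
   is positive. *)
have [x xn] := @solve_monicpoly C n (fun=> -1) n1.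
have sx : \sum_(k < n.+1) x ^+ k = 0.
  rewrite big_ord_recr /= xn -big_split big1 // => k _.
  by rewrite mulN1r; exact: subrr.
exists x => //; have := subrX1 x n.+1; rewrite sx mulr0 => /eqP.
rewrite subr_eq0 => /eqP xn1; apply/eqP.
by rewrite -(@pexpr_eq1 _ _ n.+1) // -normrX xn1 normr1.
Qed.

Lemma swift_phases_complete_bipartite (R : realType) n1 n2 :
  (2 <= n1)%N -> (2 <= n2)%N ->
  swift_phases R (complete_bipartite_graph n1 n2).
Proof.
move=> h1 h2.
have [x x1 sx] := @sum_expr_eq0_exists R[i] n1 h1.
have [y y1 sy] := @sum_expr_eq0_exists R[i] n2 h2.
pose B : 'M[R[i]]_(n1, n2) := \matrix_(j, k) (x ^+ j * y ^+ k).
pose B' : 'M[R[i]]_(n2, n1) := \matrix_(k, j) (B j k)^*%R.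
exists (block_mx 0 B B' 0); split; first split.
- apply: hermsymmxP => j k; rewrite !mxE.
  case Ej: (split j) => [j'|j']; case Ek: (split k) => [k'|k'];
    by rewrite !(mxE, Ej, Ek) ?rmorph0 ?conjCK.
- move=> j k; rewrite !mxE /= /complete_bipartite_rel.
  case: splitP => j' _; rewrite mxE; case: splitP => k' _; rewrite !mxE //= => _.
    by rewrite normrM !normrX x1 y1 !expr1n mulr1.
  by rewrite norm_conjC normrM !normrX x1 y1 !expr1n mulr1.
- move=> j k; rewrite !mxE /= /complete_bipartite_rel.
  by case: splitP => j' _; rewrite mxE; case: splitP => k' _; rewrite !mxE.
- apply/colP => j; rewrite -col_mx_const mul_block_col !mul0mx add0r addr0 !mxE.
  case: split => i; rewrite !mxE.
    under eq_bigr do rewrite !mxE mulr1.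
    by rewrite -mulr_sumr sy mulr0.
  (* In the lower rows the conjugate of a power of [y] factors out, leaving the conjugate of the sum
     of the powers of [x]. *)
  under eq_bigr do rewrite !mxE mulr1 rmorphM.
  by rewrite -mulr_suml -rmorph_sum sx rmorph0 mul0r.
Qed.

Local Close Scope complex_scope.
Local Close Scope ring_scope.

Theorem theorem4 (R : realType) :
  (forall N : nat, 3 <= N -> swift_phases R (complete_graph N)) /\
  (forall N1 N2 : nat, 2 <= N1 -> 2 <= N2 ->
     swift_phases R (complete_bipartite_graph N1 N2)).
Proof.
split=> [n n3|n1 n2]; last exact: swift_phases_complete_bipartite.
case: (boolP (odd n)) => [on|en]; first exact: swift_phases_complete_odd.
exact: swift_phases_complete_even.
Qed.
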